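(* Let $K \subseteq \mathbf{R}^n$ be a non-empty closed $\mathcal{C}^1$-hypersurface and let $\Omega$ be an open subset of $\mathbf{R}^n$ such that $\partial \Omega = K$. Then $\Omega \setminus \overline{\Sigma(K)} \neq \varnothing$ if and only if there exists a non-empty subset $S \subseteq K$, relatively open in $K$, such that $\Omega$ satisfies an inner uniform ball condition on $S$.
   Context: For a non-empty closed set $K \subseteq \mathbf{R}^n$, $\delta_K(x) = \inf\{|x-a| : a \in K\}$ is the distance function from $K$, and its singular set is $\Sigma(K) = \{x \in \mathbf{R}^n \setminus K : \delta_K \text{ is not differentiable at } x\}$; $\overline{\Sigma(K)}$ is its closure in $\mathbf{R}^n$. A set $M \subseteq \mathbf{R}^n$ is a $\mathcal{C}^1$-hypersurface if for every $a \in M$ there exist an open set $U \subseteq \mathbf{R}^n$ containing $a$, an $(n-1)$-dimensional linear subspace $Z$ of $\mathbf{R}^n$, and a $\mathcal{C}^1$-diffeomorphism $\sigma : U \to \sigma(U)$ onto an open subset of $\mathbf{R}^n$ (i.e. $\sigma$ and $\sigma^{-1}$ are both of class $\mathcal{C}^1$) such that $\sigma(U \cap M) = Z \cap \sigma(U)$. For an open set $\Omega \subseteq \mathbf{R}^n$ and $S \subseteq \partial\Omega$, $\Omega$ satisfies an inner uniform ball condition on $S$ if there exists $\rho > 0$ such that each $x \in S$ belongs to the boundary of an open ball $B$ of radius $\rho$ which is contained in $\Omega$. *)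

(* Defs.v *)
From HB Require Import structures.
From mathcomp Require Import all_boot all_order all_algebra.
From mathcomp Require Import all_classical all_reals all_analysis.
Import Order.TTheory GRing.Theory Num.Theory.
Import numFieldNormedType.Exports.

Set Implicit Arguments.
Unset Strict Implicit.
Unset Printing Implicit Defensive.

Local Open Scope classical_set_scope.
Local Open Scope ring_scope.

(* The library norm `|x| on 'rV[R]_n is the sup norm, so the Euclidean norm is
   needed for distances and balls.  Open sets, closures and differentiability
   do not depend on this choice, and the library notions are used for them. *)
Definition enorm (R : realType) (n : nat) (x : 'rV[R]_n) : R :=
  Num.sqrt (\sum_(i < n) x ord0 i ^+ 2).

(* [inf] is the infimum only for a non-empty set bounded below, that is, for
   non-empty K. *)
Definition dist (R : realType) (n : nat) (K : set 'rV[R]_n) (x : 'rV[R]_n) : R :=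
  inf [set enorm (x - a) | a in K].

Definition singular_set (R : realType) (n : nat) (K : set 'rV[R]_n) :
    set 'rV[R]_n :=
  [set x | ~ K x /\ ~ differentiable (dist K) x].

Definition boundary (T : topologicalType) (A : set T) : set T :=
  closure A `\` interior A.

(* Meant for open U, so that the total function f is only constrained on U. *)
Definition C1_on (R : realType) (n m : nat) (U : set 'rV[R]_n)
    (f : 'rV[R]_n -> 'rV[R]_m) : Prop :=
  forall x, U x ->
    differentiable f x /\ {for x, continuous (fun y => jacobian f y)}.

(* [tau] extends the inverse of [sigma : U -> sigma @` U] arbitrarily outside
   of [sigma @` U]. *)
Definition C1_diffeo_on (R : realType) (n : nat) (U : set 'rV[R]_n)
    (sigma : 'rV[R]_n -> 'rV[R]_n) : Prop :=
  open (sigma @` U) /\ C1_on U sigma /\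
  exists tau : 'rV[R]_n -> 'rV[R]_n,
    (forall x, U x -> tau (sigma x) = x) /\ C1_on (sigma @` U) tau.

(* For n = 0 no Z has dimension n - 1, so M must be empty. *)
Definition C1_hypersurface (R : realType) (n : nat) (M : set 'rV[R]_n) : Prop :=
  forall a, M a ->
    exists (U : set 'rV[R]_n) (Z : {vspace 'rV[R]_n})
           (sigma : 'rV[R]_n -> 'rV[R]_n),
      [/\ open U /\ U a, (\dim Z).+1 = n, C1_diffeo_on U sigma &
          sigma @` (U `&` M) = [set` Z] `&` sigma @` U].

Definition inner_uniform_ball_condition (R : realType) (n : nat)
    (Omega S : set 'rV[R]_n) : Prop :=
  exists2 rho : R, 0 < rho &
    forall x, S x -> exists c : 'rV[R]_n,
      boundary (ball_ (@enorm R n) c rho) x /\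
      ball_ (@enorm R n) c rho `<=` Omega.

Definition relatively_open (T : topologicalType) (K S : set T) : Prop :=
  exists2 V : set T, open V & S = K `&` V.

(* Main.v *)
From HB Require Import structures.
Require Import Defs.
From mathcomp Require Import all_boot all_order all_algebra.
From mathcomp Require Import all_classical all_reals all_analysis.
From mathcomp Require Import ring lra.
Import Order.TTheory GRing.Theory Num.Theory.
Import numFieldNormedType.Exports.

Set Implicit Arguments.
Unset Strict Implicit.
Unset Printing Implicit Defensive.

Local Open Scope classical_set_scope.
Local Open Scope ring_scope.

(** Both directions rest on the fact that, where the distance is differentiable at
    a point y off K, its gradient is the unit vector from any nearest point b to
    y: the function |. - b| touches the distance from above at y ([grad_dist]).
    The hypersurface enters only through a local equation: near each of its points K is the zero set of a
    C1 function f with non-vanishing gradient g ([hypersurface_equation]).  A ball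
    disjoint from K and touching it at b has its centre on the normal line
    b + R g(b), because f has a constant sign on the part of the ball close to b
    ([center_along_grad]).

    Inner balls produce regular points.  Suppose that every point b of K near b0
    is touched by the ball of radius rho lying in Omega on the side f > 0.  Let y
    be near b0 with f y > 0 and let b be nearest to y.  The ball around y through
    b lies on the side f > 0 as well, so y is on the radius joining b to the
    centre c of the inner ball at b.  Then rho - |z - c| <= dist z <= |z - b| for
    all z, with equality at z = y, and both bounds have the gradient
    (y - b) / |y - b| there; hence the distance is differentiable at all these y,
    and they form a non-empty open set ([regular_point_near]).  The inner balls
    may also switch sides, but having one on a given side is a closed condition
    on b, so after moving b0 and replacing f by - f a single side suffices
    ([inner_ball_regular_point]).

    Regular points produce inner balls.  Let the distance be differentiable around
    x in Omega, d = dist x, and let a be the point of K nearest to x.  It has to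
    be shown that each b in K close to a is a nearest point of some y near x with
    dist y = d; topologically this is an invariance of domain statement, but a
    variational argument is enough.  Take for y the point of {dist >= d}, within a
    small closed ball around x, which is nearest to b.  It is close to x, so by
    Lagrange multipliers y - b is a positive multiple of the gradient e of the
    distance at y, and dist y = d ([superlevel_minimizer]).  If b' is a nearest
    point of y then y - b' = d e, so b and b' are points of K near a whose
    difference is parallel to e, a direction close to the normal of K at a.  By
    Rolle's theorem for f along the segment between them this forces b = b'
    ([transversal_eq]), and the ball of radius d around y touches K at b. *)

(** * Euclidean geometry of row vectors *)

Section EuclideanSpace.
Context {R : realType} {n : nat}.
Implicit Types (u v w x y z : 'rV[R]_n) (a r : R).

Definition dotp u v : R := \sum_(i < n) u ord0 i * v ord0 i.

Lemma dotpC u v : dotp u v = dotp v u.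
Proof. by apply: eq_bigr => i _; rewrite mulrC. Qed.

Lemma dotpDl u v w : dotp (u + v) w = dotp u w + dotp v w.
Proof. by rewrite -big_split; apply: eq_bigr => i _; rewrite mxE mulrDl. Qed.

Lemma dotpZl a u v : dotp (a *: u) v = a * dotp u v.
Proof. by rewrite mulr_sumr; apply: eq_bigr => i _; rewrite mxE mulrA. Qed.

Lemma dotpNl u v : dotp (- u) v = - dotp u v.
Proof. by rewrite -scaleN1r dotpZl mulN1r. Qed.

Lemma dotpBl u v w : dotp (u - v) w = dotp u w - dotp v w.
Proof. by rewrite dotpDl dotpNl. Qed.

Lemma dotpDr u v w : dotp w (u + v) = dotp w u + dotp w v.
Proof. by rewrite !(dotpC w) dotpDl. Qed.

Lemma dotpZr a u v : dotp u (a *: v) = a * dotp u v.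
Proof. by rewrite !(dotpC u) dotpZl. Qed.

Lemma dotpNr u v : dotp u (- v) = - dotp u v.
Proof. by rewrite !(dotpC u) dotpNl. Qed.

Lemma dotpBr u v w : dotp w (u - v) = dotp w u - dotp w v.
Proof. by rewrite !(dotpC w) dotpBl. Qed.

Definition dotpE := (dotpDl, dotpDr, dotpNl, dotpNr, dotpZl, dotpZr).

Lemma dotp_ge0 u : 0 <= dotp u u.
Proof. by apply: sumr_ge0 => i _; rewrite -expr2 sqr_ge0. Qed.

Lemma enorm_sqr u : enorm u ^+ 2 = dotp u u.
Proof.
rewrite sqr_sqrtr; first by apply: eq_bigr => i _; rewrite expr2.
by apply: sumr_ge0 => i _; rewrite sqr_ge0.
Qed.

Lemma enorm_ge0 u : 0 <= enorm u. Proof. exact: sqrtr_ge0. Qed.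

Lemma dotp_eq0 u : dotp u u <= 0 -> u = 0.
Proof.
move=> u0; have /eqP : dotp u u = 0 by apply/eqP; rewrite eq_le u0 dotp_ge0.
rewrite psumr_eq0; last by move=> i _; rewrite -expr2 sqr_ge0.
move=> /allP h; apply/rowP => i; rewrite mxE; apply/eqP.
by have := h i (mem_index_enum _); rewrite -expr2 sqrf_eq0.
Qed.

Lemma enorm_eq0 u : enorm u <= 0 -> u = 0.
Proof.
move=> u0; apply: dotp_eq0; rewrite -enorm_sqr.
have /eqP-> : enorm u == 0 by rewrite eq_le u0 enorm_ge0.
by rewrite expr0n.
Qed.

Lemma enorm0 : enorm (0 : 'rV[R]_n) = 0.
Proof. by rewrite /enorm big1 ?sqrtr0// => i _; rewrite mxE expr0n. Qed.

Lemma enorm_gt0 u : u != 0 -> 0 < enorm u.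
Proof.
by move=> u0; rewrite ltNge; apply: contra u0 => /enorm_eq0/eqP.
Qed.

Lemma enormZ a u : enorm (a *: u) = `|a| * enorm u.
Proof.
apply/eqP; rewrite -(eqrXn2 (n := 2)) ?mulr_ge0 ?enorm_ge0//.
by rewrite exprMn !enorm_sqr !dotpE real_normK ?num_real// expr2 mulrA.
Qed.

Lemma enormN u : enorm (- u) = enorm u.
Proof. by rewrite -scaleN1r enormZ normrN1 mul1r. Qed.

Lemma enormC u v : enorm (u - v) = enorm (v - u).
Proof. by rewrite -enormN opprB. Qed.

(** Cauchy-Schwarz: expand the square of [enorm v *: u - enorm u *: v]. *)
Lemma dotp_le u v : dotp u v <= enorm u * enorm v.
Proof.
have [->|u0] := eqVneq u 0.
  rewrite -(scale0r 0) dotpZl mul0r scale0r enorm0 mul0r//.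
have [->|v0] := eqVneq v 0.
  rewrite -(scale0r 0) dotpZr mul0r scale0r enorm0 mulr0//.
have a0 := enorm_gt0 u0; have b0 := enorm_gt0 v0.
have := dotp_ge0 (enorm v *: u - enorm u *: v).
rewrite !dotpE (dotpC v u) -!enorm_sqr => h.
suff : 0 <= enorm u * enorm v * (enorm u * enorm v - dotp u v).
  by rewrite pmulr_rge0 ?mulr_gt0// subr_ge0.
nra.
Qed.

Lemma norm_dotp_le u v : `|dotp u v| <= enorm u * enorm v.
Proof.
by rewrite ler_norml dotp_le -lerNl -dotpNl -(enormN u) dotp_le.
Qed.

Lemma enormD u v : enorm (u + v) <= enorm u + enorm v.
Proof.
rewrite -(ler_pXn2r (n := 2)) ?nnegrE ?addr_ge0 ?enorm_ge0//.
rewrite sqrrD !enorm_sqr !dotpE (dotpC v u) mulr2n.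
have := dotp_le u v; lra.
Qed.

Lemma enormB_le u v w : enorm (u - w) <= enorm (u - v) + enorm (v - w).
Proof. by have := enormD (u - v) (v - w); rewrite addrA subrK. Qed.

Lemma norm_le_enorm u : `|u| <= enorm u.
Proof.
rewrite [leLHS]/Num.norm /= mx_normrE; apply: bigmax_le; first exact: enorm_ge0.
move=> [i j] _ /=; rewrite (ord1 i) -(ler_pXn2r (n := 2)) ?nnegrE ?enorm_ge0//.
rewrite enorm_sqr real_normK ?num_real// /dotp (bigD1 j)//= -expr2 lerDl.
by apply: sumr_ge0 => k _; rewrite -expr2 sqr_ge0.
Qed.

Lemma enorm_le_norm u : enorm u <= n%:R * `|u|.
Proof.
rewrite -(ler_pXn2r (n := 2)) ?nnegrE ?enorm_ge0 ?mulr_ge0// enorm_sqr.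
have h (i : 'I_n) : `|u ord0 i| <= `|u|.
  rewrite [leRHS]/Num.norm /= mx_normrE.
  by apply/bigmax_geP; right; exists (ord0, i).
apply: (@le_trans _ _ (\sum_(i < n) `|u| ^+ 2)).
  apply: ler_sum => i _; rewrite -expr2 -[leLHS]real_normK ?num_real//.
  by rewrite ler_pXn2r ?nnegrE.
rewrite sumr_const card_ord -[leLHS]mulr_natl exprMn ler_wpM2r ?sqr_ge0//.
by rewrite -natrX ler_nat; case: (n) => // m; rewrite leq_pmulr.
Qed.

(** The sup norm and the Euclidean norm are equivalent, so neighbourhoods can be
    described by Euclidean balls; all later estimates are Euclidean. *)
Lemma nbhs_enormP x (A : set 'rV[R]_n) :
  nbhs x A <-> exists2 r, 0 < r & forall y, enorm (y - x) < r -> A y.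
Proof.
split=> [/(@nbhs_normP _ 'rV[R]_n)[r /= r0 rA]|[r r0 rA]].
  exists r => // y yx; apply: rA => /=; rewrite distrC.
  exact: le_lt_trans (norm_le_enorm _) yx.
apply/(@nbhs_normP _ 'rV[R]_n); exists (r / n.+1%:R); first by rewrite /= divr_gt0.
move=> y /=; rewrite distrC ltr_pdivlMr// => yx; apply: rA.
apply: le_lt_trans (enorm_le_norm _) _; apply: le_lt_trans yx.
by rewrite mulrC ler_wpM2l// ler_nat.
Qed.

Lemma open_eball x r : open [set y | enorm (y - x) < r].
Proof.
rewrite openE => y /= yx; apply/nbhs_enormP; exists (r - enorm (y - x)).
  by rewrite subr_gt0.
by move=> z zy; have := enormB_le z y x => /=; lra.
Qed.

Lemma continuous_enormP (f : 'rV[R]_n -> R) x :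
  {for x, continuous f} <-> forall e : R, 0 < e ->
    exists2 r, 0 < r & forall y, enorm (y - x) < r -> `|f y - f x| < e.
Proof.
split=> [/cvgrPdist_lt fx e e0|h].
  have /(@nbhs_enormP x)[r r0 xr] := fx e e0.
  by exists r => // y /xr /=; rewrite distrC.
move=> A /nbhs_normP[e /= /h[r r0 xr] eA]; apply/(@nbhs_enormP x).
by exists r => // y /xr yx; apply: eA; rewrite /= distrC.
Qed.

Lemma enorm_lipschitz u v : `|enorm u - enorm v| <= enorm (u - v).
Proof.
have := enormB_le u v 0; have := enormB_le v u 0.
by rewrite !subr0 (enormC v u) ler_distl => *; apply/andP; split; lra.
Qed.

Lemma continuous_enormB u : continuous (fun y => enorm (y - u)).
Proof.
move=> x; apply/continuous_enormP => e e0; exists e => // y yx.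
apply: le_lt_trans (enorm_lipschitz _ _) _.
by rewrite opprB addrA subrK.
Qed.

End EuclideanSpace.

(** * Euclidean gradients *)

Section Gradient.
Context {R : realType} {n : nat}.
Implicit Types (f u l : 'rV[R]_n -> R) (x y v h g p : 'rV[R]_n).

(** Differentiability with the gradient as explicit data: all the functions below
    are compared with each other by inequalities, which pass to this form
    directly. *)
Definition has_grad f x g := forall e : R, 0 < e -> exists2 r, 0 < r &
  forall h, enorm h < r -> `|f (x + h) - f x - dotp g h| <= e * enorm h.

Lemma dotp_linear g : linear (dotp g).
Proof. by move=> a u v; rewrite dotpDr dotpZr. Qed.

HB.instance Definition _ g :=
  GRing.isLinear.Build R 'rV[R]_n R *:%R (dotp g) (dotp_linear g).

Lemma dotp_continuous g : continuous (dotp g).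
Proof.
move=> x; apply/continuous_enormP => e e0.
have g1 : 0 < enorm g + 1 by rewrite ltr_wpDl ?enorm_ge0.
exists (e / (enorm g + 1)); first by rewrite divr_gt0.
move=> y; rewrite ltr_pdivlMr// => yx; rewrite -linearB /=.
apply: le_lt_trans (norm_dotp_le _ _) _; apply: le_lt_trans yx.
by rewrite mulrC ler_wpM2l ?enorm_ge0// lerDl.
Qed.

(** Riesz representation of a linear form. *)
Lemma linear_dotp (L : {linear 'rV[R]_n -> R}) h :
  L h = dotp (\row_i L (delta_mx ord0 i)) h.
Proof.
rewrite [in LHS](row_sum_delta h) linear_sum; apply: eq_bigr => i _.
by rewrite linearZ /= mxE mulrC.
Qed.

Lemma differentiable_has_grad f x : differentiable f x ->
  has_grad f x (\row_i 'd f x (delta_mx ord0 i)).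
Proof.
move=> /diff_locally/eqaddoP df e e0.
have /(@nbhs_enormP R n 0)[r r0 rdf] := df e e0.
exists r => // h hr; have := rdf h; rewrite subr0 => /(_ hr) /=.
rewrite -linear_dotp.
rewrite [X in `|X| <= _](_ : _ = f (h + x) - (f x + 'd f x h))//.
rewrite [h + x]addrC opprD addrA.
move=> /le_trans; apply; rewrite ler_wpM2l ?(ltW e0)//.
exact: norm_le_enorm.
Qed.

Lemma has_grad_differentiable f x g : has_grad f x g -> differentiable f x.
Proof.
move=> fg; have fE : f \o shift x = cst (f x) + dotp g +o_ (0 : 'rV[R]_n) id.
  apply/eqaddoP => e e0; apply/(@nbhs_enormP R n 0).
  have n1 : (0 : R) < n.+1%:R by [].
  have [r r0 rfg] := fg _ (divr_gt0 e0 n1); exists r => // h.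
  rewrite subr0 => /rfg hr.
  rewrite [X in `|X| <= _](_ : _ = f (h + x) - (f x + dotp g h))//.
  rewrite [h + x]addrC opprD addrA; apply: le_trans hr _.
  rewrite mulrAC ler_pdivrMr// -mulrA ler_wpM2l ?(ltW e0)//.
  apply: le_trans (enorm_le_norm _) _.
  by rewrite mulrC ler_wpM2l// ler_nat.
by apply/diff_locallyP; rewrite (diff_unique (@dotp_continuous g) fE);
  split=> //; exact: dotp_continuous.
Qed.

Lemma has_grad_continuous f x g : has_grad f x g -> {for x, continuous f}.
Proof. by move=> /has_grad_differentiable/differentiable_continuous. Qed.

Lemma has_gradN f x g : has_grad f x g -> has_grad (fun y => - f y) x (- g).
Proof.
move=> fg e /fg[r r0 h]; exists r => // k /h.
by rewrite dotpNl -!opprD normrN.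
Qed.

Lemma has_grad_incr f x g v : has_grad f x g -> 0 < dotp g v ->
  exists2 r : R, 0 < r & forall t, 0 < t -> t < r -> f x < f (x + t *: v).
Proof.
move=> fg gv.
have v0 : 0 < enorm v.
  rewrite lt_def enorm_ge0 andbT; apply: contraTneq gv => v0.
  by rewrite (@enorm_eq0 _ _ v) ?v0// linear0 ltxx.
have [|r r0 h] := fg (dotp g v / (2 * enorm v)).
  by rewrite divr_gt0// mulr_gt0.
exists (r / enorm v) => [|t t0]; first by rewrite divr_gt0.
rewrite ltr_pdivlMr// => tr.
have := h (t *: v); rewrite enormZ gtr0_norm// => /(_ tr).
rewrite dotpZr [leRHS](_ : _ = t * dotp g v / 2); last first.
  by field; rewrite gt_eqF.
have : 0 < t * dotp g v by rewrite mulr_gt0.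
by rewrite ler_norml => ? /andP[? ?]; lra.
Qed.

Lemma has_grad_ge0 f x g v : has_grad f x g ->
  (forall r : R, 0 < r ->
    exists t, [/\ 0 < t, t < r & f x <= f (x + t *: v)]) ->
  0 <= dotp g v.
Proof.
move=> /has_gradN fg h; rewrite leNgt; apply/negP => gv.
have [|r /h[t [t0 tr ft]] /(_ t t0 tr)] := has_grad_incr (v := v) fg.
  by rewrite dotpNl oppr_gt0.
by rewrite ltrN2 ltNge ft.
Qed.

(** The difference of the two functions has a minimum at the point of contact,
    where its gradient must vanish. *)
Lemma has_grad_touch f u x g g' : has_grad f x g -> has_grad u x g' ->
  f x = u x -> (forall y, f y <= u y) -> g = g'.
Proof.
move=> fg ug fu le_fu; apply/subr0_eq/dotp_eq0.
have : has_grad (fun y => u y - f y) x (g' - g).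
  move=> e e0; have e2 : 0 < e / 2 by rewrite divr_gt0.
  have [r r0 hf] := fg _ e2; have [s s0 hu] := ug _ e2.
  exists (Num.min r s) => [|h]; rewrite lt_min ?r0// => /andP[/hf hr /hu hs].
  rewrite dotpBl; move: hr hs; rewrite !ler_norml => /andP[? ?] /andP[? ?].
  by apply/andP; split; lra.
move=> /(@has_grad_ge0 _ _ _ (g - g')).
rewrite -(opprB g g') dotpNl oppr_ge0; apply.
move=> r r0; exists (r / 2); rewrite fu subrr subr_ge0 le_fu.
by split=> //; lra.
Qed.

Lemma has_grad_squeeze l f u x g : has_grad l x g -> has_grad u x g ->
  l x = f x -> u x = f x -> (forall y, l y <= f y) -> (forall y, f y <= u y) ->
  has_grad f x g.
Proof.
move=> lg ug lx ux lf fu e e0; have [r r0 hl] := lg _ e0.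
have [s s0 hu] := ug _ e0; exists (Num.min r s) => [|h].
  by rewrite lt_min r0.
rewrite lt_min => /andP[/hl + /hu]; rewrite lx ux !ler_norml.
have := lf (x + h); have := fu (x + h).
by move=> ? ? /andP[? ?] /andP[? ?]; apply/andP; split; lra.
Qed.

(** The norm lies above its tangent by Cauchy-Schwarz, and the inequality
    [(M - N) ^+ 2 >= 0] bounds it from above by the tangent plus a quadratic
    term. *)
Lemma has_grad_enorm p x : x != p ->
  has_grad (fun y => enorm (y - p)) x ((enorm (x - p))^-1 *: (x - p)).
Proof.
rewrite -subr_eq0 => /enorm_gt0; move wE : (x - p) => w.
set N := enorm w => N0 e e0.
exists (2 * N * e) => [|h hr]; first by rewrite !mulr_gt0.
rewrite [x + h - p]addrAC wE dotpZl -/N; set M := enorm (w + h); set q := dotp w h.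
have q1 : N ^-1 * q * N = q by field; rewrite gt_eqF.
have M2 : M ^+ 2 = N ^+ 2 + 2 * q + enorm h ^+ 2.
  by rewrite /M /N !enorm_sqr !dotpE (dotpC h w) -/q; ring.
have MN : N ^+ 2 + q <= M * N.
  by apply: le_trans (dotp_le _ _); rewrite /N enorm_sqr dotpDl (dotpC h).
have hh : enorm h * enorm h <= 2 * N * e * enorm h.
  by rewrite ler_wpM2r ?enorm_ge0// ltW.
move: q1; set k := N ^-1 * q => q1.
have lo : 0 <= M - N - k by rewrite -(pmulr_lge0 _ N0) !mulrBl q1 -expr2; lra.
rewrite ger0_norm// -(ler_pM2r N0) -(@ler_pM2l _ 2)// !mulrBl q1.
have := sqr_ge0 (M - N); nra.
Qed.

End Gradient.

(** * Half-spaces, convex sets and touching balls *)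

Section Halfspace.
Context {R : realType} {n : nat}.
Implicit Types (x y z v w e g p : 'rV[R]_n) (A C : set 'rV[R]_n).

(** Farkas' lemma for one inequality.  Write w = k e + q with q orthogonal to e;
    the vectors t e - q with t > 0 are in the half-space, and letting t tend to 0
    gives - |q|^2 >= 0.  This is how Lagrange multipliers arise below. *)
Lemma halfspace_dual e w : e != 0 ->
  (forall v, 0 < dotp e v -> 0 <= dotp w v) ->
  exists2 k : R, 0 <= k & w = k *: e.
Proof.
move=> e0 ew; have ee : 0 < dotp e e.
  by rewrite -enorm_sqr exprn_gt0 ?enorm_gt0.
have we : 0 <= dotp w e by rewrite ew.
pose k := dotp w e / dotp e e; exists k; first by rewrite divr_ge0 ?(ltW ee).
apply/subr0_eq; set q := w - k *: e.
have eq0 : dotp e q = 0.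
  by rewrite /q dotpBr dotpZr (dotpC e w) /k divfK ?subrr// gt_eqF.
have wq : dotp w q = dotp q q.
  by rewrite {2}/q dotpBl dotpZl eq0 mulr0 subr0.
clearbody q; apply: dotp_eq0; apply/ler_addgt0Pl => r r0; rewrite addr0.
have we1 : 0 < dotp w e + 1 by rewrite ltr_wpDl.
have t0 : 0 < r / (dotp w e + 1) by rewrite divr_gt0.
(* The time t = r / (w.e + 1) makes t (w.e) at most r. *)
have := ew (r / (dotp w e + 1) *: e - q).
rewrite !dotpBr !dotpZr eq0 wq subr0 subr_ge0 => /(_ (mulr_gt0 t0 ee)).
move=> /le_trans; apply.
by rewrite mulrAC ler_pdivrMr// ler_wpM2l ?(ltW r0)// lerDl.
Qed.

Lemma continuous_line p v : continuous (fun t : R => p + t *: v).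
Proof.
by move=> t; apply: cvgD; [exact: cvg_cst|exact: scalel_continuous].
Qed.

Definition segment_convex C := forall y z (t : R),
  C y -> C z -> 0 <= t -> t <= 1 -> C (y + t *: (z - y)).

Lemma segment_convex_eball x (r : R) :
  segment_convex [set y | enorm (y - x) < r].
Proof.
move=> y z t /= yr zr t0 t1.
have -> : y + t *: (z - y) - x = (1 - t) *: (y - x) + t *: (z - x).
  by apply/rowP => i; rewrite !mxE; ring.
apply: le_lt_trans (enormD _ _) _.
rewrite !enormZ !ger0_norm ?subr_ge0//.
by have [ab|/ltW ab] := leP (enorm (y - x)) (enorm (z - x)); nra.
Qed.

Lemma segment_convexI A C :
  segment_convex A -> segment_convex C -> segment_convex (A `&` C).
Proof. by move=> hA hC y z t [? ?] [? ?] ? ?; split; [apply: hA|apply: hC]. Qed.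

(** On a segment that avoids the boundary, the trace of [A] is both open, as the
    trace of its interior, and closed, as the trace of its closure. *)
Lemma convex_subset_of_boundary_free C A y : segment_convex C ->
  (forall z, C z -> ~ boundary A z) -> C y -> A y -> C `<=` A.
Proof.
move=> Ccvx CA Cy Ay z Cz; pose p (t : R) := y + t *: (z - y).
have pC t : `[0, 1]%classic t -> C (p t).
  by rewrite /= in_itv /= => /andP[t0 t1]; exact: Ccvx.
have pA t : `[0, 1]%classic t -> closure A (p t) -> A^° (p t).
  by move=> /pC/CA nA cA; apply: contrapT => iA; apply: nA; split.
have pcont : continuous p by exact: continuous_line.
pose B := `[0, 1]%classic `&` p @^-1` A^°.
have : B = `[0, 1]%classic.
  apply: (@segment_connected R 0 1).
  - exists 0; split; first by rewrite /= in_itv /= lexx ler01.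
    have := @pA 0; rewrite /preimage/= /p scale0r addr0.
    by apply; [rewrite /= in_itv /= lexx ler01|exact: subset_closure].
  - exists (p @^-1` A^°) => //.
    by apply: open_comp; [move=> t _; exact: pcont|exact: open_interior].
  - exists (p @^-1` closure A).
      by apply: closed_comp; [move=> t _; exact: pcont|exact: closed_closure].
    apply/seteqP; split=> t [t01 h]; split=> //; last exact: pA.
    by apply: subset_closure; exact: interior_subset.
move=> /(congr1 (fun D : set R => D 1)) /=.
rewrite /B /= in_itv /= lexx ler01 => h.
have [_] : true /\ (A^°) (p 1) by rewrite h.
by move=> /interior_subset; rewrite /p scale1r addrC subrK.
Qed.

Lemma boundary_pos_zero (f : 'rV[R]_n -> R) z : {for z, continuous f} ->
  boundary [set y | 0 < f y] z -> f z = 0.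
Proof.
move=> /continuous_enormP fz [cz iz].
have [fz0|fz0|//] := ltgtP (f z) 0.
- have [|r r0 h] := fz (- f z); first by rewrite oppr_gt0.
  have : nbhs z [set y | f y < 0].
    by apply/nbhs_enormP; exists r => // y /h; rewrite ltr_norml => /andP[? ?] /=; lra.
  by move=> /cz[y /= [? ?]]; lra.
- have [r r0 h] := fz _ fz0; exfalso; apply: iz; apply/nbhs_enormP.
  by exists r => // y /h; rewrite ltr_norml => /andP[? ?] /=; lra.
Qed.

Lemma convex_pos (f : 'rV[R]_n -> R) C y : segment_convex C ->
  (forall z, C z -> {for z, continuous f}) -> (forall z, C z -> f z != 0) ->
  C y -> 0 < f y -> forall z, C z -> 0 < f z.
Proof.
move=> Ccvx fc f0 Cy fy; apply: (@convex_subset_of_boundary_free C _ y) => //.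
by move=> z Cz /(boundary_pos_zero (fc z Cz)) fz; have := f0 z Cz; rewrite fz eqxx.
Qed.

Lemma convex_sign (f : 'rV[R]_n -> R) C : segment_convex C ->
  (forall z, C z -> {for z, continuous f}) -> (forall z, C z -> f z != 0) ->
  (forall z, C z -> 0 < f z) \/ (forall z, C z -> 0 < - f z).
Proof.
move=> Ccvx fc f0.
have [[y Cy fy]|h] := pselect (exists2 y, C y & 0 < f y).
  by left; exact: (convex_pos Ccvx fc f0 Cy fy).
right=> z Cz; rewrite oppr_gt0 lt_neqAle f0//= leNgt; apply/negP => fz.
by apply: h; exists z.
Qed.

(** Every direction [v] with [dotp (x - a) v > 0] enters the ball with centre [x]
    through [a], where [f] is positive; since [f a = 0] its derivative along [v]
    is non-negative, and the half-space lemma applies. *)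
Lemma grad_on_sphere (f : 'rV[R]_n -> R) a x g (eta : R) :
  has_grad f a g -> f a = 0 -> x != a -> 0 < eta ->
  (forall z, enorm (z - x) < enorm (a - x) -> enorm (z - a) < eta ->
     0 < f z) ->
  exists2 k : R, 0 <= k & g = k *: (x - a).
Proof.
move=> fg fa xa eta0 fpos; apply: halfspace_dual; first by rewrite subr_eq0.
move=> v xv; have := has_grad_enorm (p := x) (x := a).
rewrite eq_sym => /(_ xa)/has_gradN/(@has_grad_incr _ _ _ _ _ v).
have ax : 0 < enorm (a - x) by rewrite enorm_gt0// subr_eq0 eq_sym.
rewrite -scalerN opprB dotpZl; case; first by rewrite mulr_gt0 ?invr_gt0.
move=> s s0 hs; apply: (has_grad_ge0 fg) => r r0.
have v1 : 0 < enorm v + 1 by rewrite ltr_wpDl ?enorm_ge0.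
have q0 : 0 < eta / (enorm v + 1) by rewrite divr_gt0.
have [t /andP[t0]] : exists t : R,
    0 < t < Num.min r (Num.min s (eta / (enorm v + 1))).
  set m := Num.min _ _; have m0 : 0 < m by rewrite !lt_min r0 s0.
  by exists (m / 2); apply/andP; split; lra.
rewrite !lt_min ltr_pdivlMr// => /and3P[tr ts te].
exists t; split=> //; rewrite fa; apply/ltW/fpos.
  by have := hs t t0 ts; rewrite ltrN2.
rewrite addrC addKr enormZ gtr0_norm//.
by apply: le_lt_trans te; rewrite ler_wpM2l ?(ltW t0)// lerDl.
Qed.

End Halfspace.

(** * The distance function *)

Section Distance.
Context {R : realType} {n : nat}.
Implicit Types (x y z g p a c : 'rV[R]_n) (A K : set 'rV[R]_n) (r : R).

(** Only the compact part of [A] no farther from [p] than a chosen point of [A]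
    matters. *)
Lemma closed_nearest A p : A !=set0 -> closed A ->
  exists2 a, A a & forall y, A y -> enorm (p - a) <= enorm (p - y).
Proof.
move=> [a0 Aa0] clA; pose B := A `&` [set y | enorm (y - p) <= enorm (a0 - p)].
have clB : closed B.
  apply: closedI => //; apply: (closed_comp _ (@closed_le _ (enorm (a0 - p)))).
  by move=> y _; exact: continuous_enormB.
have [|||a aB amin] := @EVT_min_rV R n (fun y => enorm (y - p)) B.
- by exists a0; split => /=.
- apply: bounded_closed_compact => //.
  exists (enorm (a0 - p) + enorm p); split=> [|M /ltW hM y [_ /= hy]].
    exact: num_real.
  apply: le_trans hM; apply: le_trans (norm_le_enorm _) _.
  by have := enormD (y - p) p; rewrite subrK; lra.
- by apply: continuous_subspaceT; exact: continuous_enormB.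
- exists a => [|y Ay]; first by move: aB; rewrite inE => -[].
  rewrite !(enormC p); have [hy|/ltW hy] := leP (enorm (y - p)) (enorm (a0 - p)).
    by apply: amin; rewrite inE; split.
  by apply: le_trans hy; apply: amin; rewrite inE; split => /=.
Qed.

Lemma dist_le K x a : K a -> dist K x <= enorm (x - a).
Proof.
move=> Ka; apply: ge_inf; last by exists a.
by exists 0 => _ [b _ <-]; exact: enorm_ge0.
Qed.

Lemma dist_ge K x r : K !=set0 -> (forall a, K a -> r <= enorm (x - a)) ->
  r <= dist K x.
Proof.
move=> [a Ka] h; apply: lb_le_inf; first by exists (enorm (x - a)), a.
by move=> _ [b /h + <-].
Qed.

Lemma dist_attained K x : K !=set0 -> closed K ->
  exists2 a, K a & dist K x = enorm (x - a).
Proof.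
move=> K0 /(closed_nearest x K0)[a Ka h]; exists a => //.
by apply/eqP; rewrite eq_le dist_le//= dist_ge.
Qed.

Lemma dist_lipschitz K x y : K !=set0 -> closed K ->
  dist K y <= dist K x + enorm (y - x).
Proof.
move=> K0 clK; have [a Ka ->] := dist_attained x K0 clK.
apply: le_trans (dist_le y Ka) _; have := enormB_le y x a; lra.
Qed.

Lemma continuous_dist K : K !=set0 -> closed K -> continuous (dist K).
Proof.
move=> K0 clK x; apply/continuous_enormP => e e0; exists e => // y yx.
have := dist_lipschitz x y K0 clK; have := dist_lipschitz y x K0 clK.
by rewrite ltr_norml (enormC x y) => *; apply/andP; split; lra.
Qed.

Lemma dist_gt0 K x : K !=set0 -> closed K -> ~ K x -> 0 < dist K x.
Proof.
move=> K0 clK nKx; have [a Ka ->] := dist_attained x K0 clK.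
by apply: enorm_gt0; apply: contra_notN nKx; rewrite subr_eq0 => /eqP->.
Qed.

(** The function [enorm (_ - a)] touches the distance from above at [x]. *)
Lemma grad_dist K x a g : K a -> dist K x = enorm (x - a) -> x != a ->
  has_grad (dist K) x g -> g = (enorm (x - a))^-1 *: (x - a).
Proof.
move=> Ka dE xa dg; apply: (has_grad_touch dg (has_grad_enorm xa) dE).
by move=> y; exact: dist_le.
Qed.

Lemma boundary_eballP c r x : 0 < r ->
  boundary (ball_ (@enorm R n) c r) x <-> enorm (c - x) = r.
Proof.
move=> r0; split=> [[clx ix]|xr].
  apply/eqP; rewrite eq_le; apply/andP; split; last first.
    rewrite leNgt; apply/negP => xr; apply: ix; apply/nbhs_enormP.
    exists (r - enorm (c - x)); first by rewrite subr_gt0.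
    by move=> y; rewrite /ball_/= enormC; have := enormB_le c x y; lra.
  apply/ler_addgt0Pl => e e0.
  have /clx[y [/= cy yx]] : nbhs x [set y | enorm (y - x) < e].
    by apply/nbhs_enormP; exists e.
  by have := enormB_le c y x; lra.
split=> [A /nbhs_enormP[s s0 sA]|]; last first.
  by move=> /interior_subset; rewrite /ball_/= xr ltxx.
(* For the closure, move from x towards the centre by less than s. *)
have [t /andP[t0 ts] t1] : exists2 t : R, 0 < t < s / r & t <= 1.
  have q0 : 0 < s / r by rewrite divr_gt0.
  have [h|h] := leP (s / r) 1; last by exists 1; rewrite ?ltr01.
  by exists (s / r / 2); [apply/andP; split|]; lra.
have cE : c - (x + t *: (c - x)) = (1 - t) *: (c - x).
  by apply/rowP => i; rewrite !mxE; ring.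
exists (x + t *: (c - x)); split.
  by rewrite /ball_/= cE enormZ xr ger0_norm ?subr_ge0// gtr_pMl//; lra.
by apply: sA; rewrite addrC addKr enormZ xr gtr0_norm// -ltr_pdivlMr.
Qed.

Lemma boundary_open A : open A -> boundary A = closure A `\` A.
Proof. by move=> oA; rewrite /boundary (interior_id _).1. Qed.

End Distance.

(** * Local equations of hypersurfaces *)

Section Hypersurface.
Context {R : realType} {n : nat}.
Implicit Types (y z v w a : 'rV[R]_n) (K U : set 'rV[R]_n) (r : R).

(** A hyperplane is the orthogonal complement of a vector: a coordinate of the
    projection along the hyperplane is a non-zero linear form vanishing on it,
    and a larger kernel would be the whole space. *)
Lemma hyperplane_normal (Z : {vspace 'rV[R]_n}) : (\dim Z).+1 = n ->
  exists2 w, w != 0 & forall v, (v \in Z) = (dotp w v == 0).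
Proof.
move=> dimZ; have dimV : \dim (fullv : {vspace 'rV[R]_n}) = n.
  by rewrite dimvf /dim /= mul1n.
have dimlt : (\dim Z < n)%N by rewrite dimZ.
have /subvPn[v0 _ v0Z] : ~~ (fullv <= Z)%VS.
  by apply/negP => /dimvS; rewrite dimV leqNgt dimlt.
have /rV0Pn[i ui] : v0 - projv Z v0 != 0.
  by apply: contra v0Z; rewrite subr_eq0 => /eqP->; exact: memv_proj.
pose phi v : R := (v - projv Z v) ord0 i.
have phi_lin : linear phi.
  by move=> k u v; rewrite /phi linearP !mxE /GRing.scale /=; ring.
pose phiL : {linear 'rV[R]_n -> R} :=
  HB.pack phi (GRing.isLinear.Build R 'rV[R]_n R *:%R phi phi_lin).
pose w : 'rV[R]_n := \row_i phiL (delta_mx ord0 i).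
have phiE v : dotp w v = phi v by rewrite -linear_dotp.
have w0 : w != 0.
  apply: contraNneq ui => w0; change (phi v0 == 0).
  by rewrite -phiE w0 dotpC linear0.
have Zw v : v \in Z -> dotp w v = 0.
  by move=> vZ; rewrite phiE /phi projv_id// subrr mxE.
exists w => // v; apply/idP/eqP => [/Zw//|wv].
apply: contraT => vZ.
have : (Z + <[v]> == fullv)%VS.
  rewrite eqEdim subvf dimV -[X in (X <= _)%N]dimZ ltnNge.
  apply: contra vZ => dimle.
  have /geq_leqif := dimv_leqif_sup (addvSl Z <[v]>).
  by rewrite dimle => /esym/subvP; apply; rewrite memvE addvSr.
move=> /eqP ZvF; have := memvf w; rewrite -ZvF => /memv_addP[z zZ [u]].
move=> /vlineP[k ->] wE; case/eqP: w0; apply: dotp_eq0.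
by rewrite {2}wE dotpDr dotpZr Zw// wv mulr0 addr0.
Qed.

Lemma continuous_row_dotp w i :
  continuous (fun M : 'M[R]_n => dotp w (row i M)).
Proof.
apply: continuous_big => [|j _ M]; first exact: add_continuous.
rewrite (_ : (fun _ => _) = *%R (w ord0 j) \o fun M : 'M[R]_n => M i j).
  by apply: continuous_comp; [exact: coord_continuous|exact: mulrl_continuous].
by apply/funext => N /=; rewrite mxE.
Qed.

Definition continuous_grad_on U (f : 'rV[R]_n -> R) (g : 'rV[R]_n -> 'rV[R]_n) :=
  forall y, U y -> has_grad f y (g y) /\ forall e : R, 0 < e ->
    exists2 r, 0 < r & forall z, enorm (z - y) < r -> enorm (g z - g y) < e.

(** The gradient of [fun z => dotp w (sigma z)]. *)
Definition chart_grad (sigma : 'rV[R]_n -> 'rV[R]_n) w y : 'rV[R]_n :=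
  \row_i dotp w (row i (jacobian sigma y)).

Lemma chart_gradE sigma w y i :
  chart_grad sigma w y ord0 i = dotp w (row i (jacobian sigma y)).
Proof. by rewrite mxE. Qed.

Lemma C1_on_dotp U (sigma : 'rV[R]_n -> 'rV[R]_n) w : C1_on U sigma ->
  continuous_grad_on U (fun z => dotp w (sigma z))
    (chart_grad sigma w).
Proof.
move=> sC1 y Uy; have [dsy Jcont] := sC1 y Uy.
have dw : differentiable (dotp w) (sigma y).
  exact/linear_differentiable/dotp_continuous.
split.
  have := differentiable_has_grad (differentiable_comp dsy dw).
  rewrite (_ : (\row_i _) = chart_grad sigma w y)//.
  apply/rowP => i; rewrite chart_gradE mxE diff_comp// diff_lin; last first.
    exact: dotp_continuous.
  by rewrite /= rowE /jacobian mul_rV_lin1.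
move: (chart_gradE sigma w); move: (chart_grad sigma w) => g gE.
pose sq i (t : R) := (t - g y ord0 i) ^+ 2.
have sq_cont i : continuous (sq i).
  move=> t; apply: (@continuous_comp _ _ _ (fun s : R => s - g y ord0 i)
    (fun s : R => s ^+ 2)).
    by apply: cvgB; [exact: cvg_id|exact: cvg_cst].
  exact: exprn_continuous.
pose G (M : 'M[R]_n) : R := \sum_i sq i (dotp w (row i M)).
have G_cont : continuous G.
  apply: continuous_big => [|i _ M]; first exact: add_continuous.
  by apply: (continuous_comp (@continuous_row_dotp w i M)); exact: sq_cont.
have : {for y, continuous (fun z => enorm (g z - g y))}.
  rewrite (_ : (fun z => _) = Num.sqrt \o G \o jacobian sigma).
    apply: (continuous_comp (g := Num.sqrt \o G)); first exact: Jcont.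
    by apply: continuous_comp; [exact: G_cont|exact: sqrt_continuous].
  apply/funext => z; rewrite [RHS]/(Num.sqrt (G _)) /G /enorm.
  congr Num.sqrt; apply: eq_bigr => i _.
  by rewrite /sq -gE mxE [(- g y) _ _]mxE.
move=> /continuous_enormP h e /h[r r0 hr]; exists r => // z /hr.
by rewrite subrr enorm0 subr0 ger0_norm ?enorm_ge0.
Qed.

(** The equation is the composition of a chart with a linear form defining the
    hyperplane; it has no critical points because the Jacobian of the chart is
    invertible. *)
Lemma hypersurface_equation K a : C1_hypersurface K -> K a ->
  exists (f : 'rV[R]_n -> R) (g : 'rV[R]_n -> 'rV[R]_n) (r : R),
    [/\ 0 < r, continuous_grad_on [set y | enorm (y - a) < r] f g,
      forall y, enorm (y - a) < r -> g y != 0 &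
      forall y, enorm (y - a) < r -> K y <-> f y = 0].
Proof.
move=> hK Ka.
have [U [Z [sigma [[oU Ua] dimZ [_ [sC1 [tau [tauK tC1]]]] sKU]]]] := hK a Ka.
have [w w0 Zw] := hyperplane_normal dimZ.
have /nbhs_enormP[r r0 rU] : nbhs a U by move: oU; rewrite openE => /(_ _ Ua).
have gradE := C1_on_dotp w sC1.
exists (fun z => dotp w (sigma z)).
exists (chart_grad sigma w), r; split=> // [y|y|y].
- by move=> /rU; exact: gradE.
- move=> /rU Uy; have [ds _] := sC1 y Uy.
  have [dt _] := tC1 (sigma y) (imageP sigma Uy).
  (* The chain rule for tau \o sigma, which is the identity near y. *)
  have JK : jacobian sigma y *m jacobian tau (sigma y) = 1%:M.
    apply/row_matrixP => i; rewrite !rowE mulmx1 mulmxA.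
    rewrite -deriveEjacobian// deriveE// -deriveEjacobian// deriveE//.
    rewrite -[LHS]/(('d tau (sigma y) \o 'd sigma y) _) -diff_comp//.
    rewrite -deriveE; last exact: differentiable_comp.
    rewrite (@near_eq_derive _ _ _ _ id) ?derive_id//.
    by move: oU; rewrite openE => /(_ _ Uy); apply: filterS => z /tauK.
  apply: contra w0 => /eqP g0; apply/eqP/dotp_eq0.
  rewrite -[X in dotp w X]mulmx1 -(mulmx1C JK) mulmxA mulmx_sum_row linear_sum.
  rewrite big1 => [//|i _]; rewrite linearZ /=.
  by rewrite -chart_gradE g0 [X in _ *: X]mxE scaler0.
- move=> /rU Uy; split=> [Ky|fy].
    have : (sigma @` (U `&` K)) (sigma y) by exists y.
    by rewrite sKU => -[/= + _]; rewrite Zw => /eqP.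
  have : ([set` Z] `&` sigma @` U) (sigma y).
    by split; [rewrite /= Zw fy|exists y].
  rewrite -sKU => -[z [Uz Kz] /(congr1 tau)].
  by rewrite !tauK// => <-.
Qed.

End Hypersurface.

(** * Rolle's theorem along segments and normals *)

Section Normals.
Context {R : realType} {n : nat}.
Implicit Types (x y z u v w p a b : 'rV[R]_n) (K : set 'rV[R]_n) (r : R).
Implicit Types (f : 'rV[R]_n -> R) (g : 'rV[R]_n -> 'rV[R]_n).

Lemma is_derive_along_line f p v (t : R) w : has_grad f (p + t *: v) w ->
  is_derive t (1 : R) (fun s : R => f (p + s *: v)) (dotp w v).
Proof.
move=> fw.
have lim_quot : h^-1 *: (f (p + (h *: (1 : R) + t) *: v) - f (p + t *: v))
    @[h --> (0 : R)^'] --> dotp w v.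
  apply/cvgrPdist_le => e e0.
  have v1 : 0 < enorm v + 1 by rewrite ltr_wpDl ?enorm_ge0.
  have [r r0 hr] := fw _ (divr_gt0 e0 v1).
  have q0 : 0 < r / (enorm v + 1) by rewrite divr_gt0.
  near=> h.
  have h0 : h != 0 by near: h; exact: nbhs_dnbhs_neq.
  have hq : `|h| < r / (enorm v + 1).
    near: h; apply: nbhs_dnbhs; apply/nbhs_normP; exists (r / (enorm v + 1)) => //.
    by move=> h /=; rewrite sub0r normrN.
  have hv : enorm (h *: v) <= `|h| * (enorm v + 1).
    by rewrite enormZ ler_wpM2l// lerDl.
  have := hr (h *: v); rewrite ltr_pdivlMr// in hq.
  rewrite (le_lt_trans hv hq) => /(_ isT) hh.
  have -> : p + (h *: (1 : R) + t) *: v = p + t *: v + h *: v.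
    by rewrite [h *: _]mulr1 scalerDl [h *: v + _]addrC addrA.
  have -> : dotp w v - h^-1 *: (f (p + t *: v + h *: v) - f (p + t *: v)) =
      - (h^-1 * (f (p + t *: v + h *: v) - f (p + t *: v) - dotp w (h *: v))).
    by rewrite dotpZr /GRing.scale/=; field.
  have nh : 0 < `|h| by rewrite normr_gt0.
  rewrite normrN normrM normfV -(ler_pM2l nh) mulVKf ?gt_eqF//.
  apply: le_trans hh _; apply: le_trans (ler_wpM2l _ hv) _.
    by rewrite divr_ge0 ?ltW.
  by rewrite mulrCA divfK ?gt_eqF.
apply: DeriveDef; first by apply/cvg_ex; exists (dotp w v); exact: lim_quot.
exact: (cvg_lim _ lim_quot).
Unshelve. all: by end_near. Qed.

Lemma rolle_segment f g p v :
  (forall t : R, 0 <= t <= 1 -> has_grad f (p + t *: v) (g (p + t *: v))) ->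
  f (p + v) = f p ->
  exists2 t : R, 0 <= t <= 1 & dotp (g (p + t *: v)) v = 0.
Proof.
move=> fg fpv; pose phi (s : R) := f (p + s *: v).
have dphi (t : R) : 0 <= t <= 1 ->
    is_derive t (1 : R) phi (dotp (g (p + t *: v)) v).
  by move=> /fg/is_derive_along_line.
have [||t] := @MVT R phi (fun t => dotp (g (p + t *: v)) v) 0 1 ltr01.
- by move=> t; rewrite in_itv/= => /andP[t0 t1]; apply: dphi; rewrite !ltW.
- apply: derivable_within_continuous => t; rewrite in_itv/= => /dphi ?.
  exact: ex_derive.
rewrite in_itv/= => /andP[t0 t1].
rewrite /phi scale1r scale0r addr0 fpv subrr subr0 mulr1 => h.
by exists t; rewrite // !ltW.
Qed.

(** Lipschitz estimate for the normalization of vectors, used for the continuity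
    of the unit normal. *)
Lemma normalized_dist u v : u != 0 -> v != 0 ->
  enorm ((enorm u)^-1 *: u - (enorm v)^-1 *: v) <= 2 * enorm (u - v) / enorm v.
Proof.
move=> /enorm_gt0 u0 /enorm_gt0 v0.
have -> : (enorm u)^-1 *: u - (enorm v)^-1 *: v =
    (enorm v)^-1 *: (u - v) + ((enorm u)^-1 - (enorm v)^-1) *: u.
  by apply/rowP => i; rewrite !mxE; ring.
apply: le_trans (enormD _ _) _; rewrite !enormZ.
have -> : (enorm u)^-1 - (enorm v)^-1 = (enorm v - enorm u) / (enorm u * enorm v).
  by field; rewrite !gt_eqF.
rewrite normrM !normfV normrM !(gtr0_norm u0) !(gtr0_norm v0).
have -> : `|enorm v - enorm u| / (enorm u * enorm v) * enorm u =
    `|enorm v - enorm u| / enorm v by field; rewrite !gt_eqF.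
rewrite [_^-1 * _]mulrC -mulrDl ler_pM2r ?invr_gt0//.
by have := enorm_lipschitz v u; rewrite (enormC v); lra.
Qed.

(** [x] is the centre of a ball disjoint from [K] and touching it at [b].  Near [b]
    the equation [f] has a constant sign on this ball, so its gradient at [b]
    points towards [x] or away from it. *)
Lemma center_along_grad K f g a r b x :
  continuous_grad_on [set y | enorm (y - a) < r] f g ->
  (forall y, enorm (y - a) < r -> g y != 0) ->
  (forall y, enorm (y - a) < r -> K y <-> f y = 0) ->
  K b -> enorm (b - a) < r -> x != b ->
  (forall y, K y -> enorm (b - x) <= enorm (y - x)) ->
  x - b = (enorm (b - x) / enorm (g b)) *: g b \/
  x - b = - (enorm (b - x) / enorm (g b)) *: g b.
Proof.
move=> fg g0 Kf Kb br xb Kx.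
have nxb : 0 < enorm (x - b) by rewrite enorm_gt0// subr_eq0.
have gb0 : 0 < enorm (g b) by rewrite enorm_gt0// g0.
(* The part C of the ball within distance eta of b is inside the domain of f. *)
set eta := r - enorm (b - a); have eta0 : 0 < eta by rewrite subr_gt0.
pose C := [set z | enorm (z - x) < enorm (b - x)] `&` [set z | enorm (z - b) < eta].
have Cr z : C z -> enorm (z - a) < r.
  by move=> [_ /= zb]; have := enormB_le z b a; rewrite /eta in zb; lra.
have Ccvx : segment_convex C.
  by apply: segment_convexI; exact: segment_convex_eball.
have fC z : C z -> f z != 0.
  move=> Cz; apply/eqP => /(Kf z (Cr z Cz)).2 /Kx.
  by rewrite leNgt Cz.1.
have fcont z : C z -> {for z, continuous f}.
  by move=> /Cr /fg[/has_grad_continuous].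
have fb : f b = 0 by apply/(Kf b br).
have gradb := (fg b br).1.
have scale_eq (k : R) : 0 <= k -> enorm (g b) = k * enorm (x - b) ->
    (enorm (b - x) / enorm (g b)) * k = 1.
  move=> k0 gE; rewrite enormC gE; field.
  by apply/andP; split; apply/eqP => h0; move: gb0 nxb; rewrite gE h0;
     rewrite ?mul0r ?ltxx.
have [fpos|fneg] := convex_sign Ccvx fcont fC; [left|right].
  have [|k k0 gk] := grad_on_sphere gradb fb xb eta0.
    by move=> z zx zb; apply: fpos.
  rewrite {2}gk scalerA scale_eq ?scale1r// gk enormZ ger0_norm//.
have [||k k0 gk] := grad_on_sphere (has_gradN gradb) _ xb eta0.
  - by rewrite fb oppr0.
  - by move=> z zx zb; apply: fneg.
rewrite -(opprK (g b)) gk enormN scalerN scaleNr opprK scalerA.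
have gE : enorm (g b) = k * enorm (x - b).
  by rewrite -enormN gk enormZ ger0_norm.
by rewrite -gk enormN scale_eq ?scale1r.
Qed.

End Normals.

(** * From inner balls to regular points *)

Section BallToRegular.
Context {R : realType} {n : nat}.
Implicit Types (x y z v a b c : 'rV[R]_n) (K Omega S : set 'rV[R]_n).
Implicit Types (r rho : R).
Implicit Types (f : 'rV[R]_n -> R) (g : 'rV[R]_n -> 'rV[R]_n).

Lemma has_gradDl f x v (k : R) :
  has_grad f x v -> has_grad (fun y => k + f y) x v.
Proof.
by move=> fv e /fv[r r0 h]; exists r => // y /h; rewrite opprD addrACA subrr add0r.
Qed.

(** The hypotheses place [y] on the radius from [b] to the centre [c] of a ball
    disjoint from [K], so the distance is squeezed between [rho - enorm (_ - c)]
    and [enorm (_ - b)], which agree at [y] together with their gradients. *)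
Lemma dist_differentiable_between K b c y rho : K !=set0 -> closed K -> K b ->
  (forall a, K a -> rho <= enorm (c - a)) ->
  0 < enorm (y - b) -> enorm (y - b) < rho ->
  c - b = (rho / enorm (y - b)) *: (y - b) ->
  has_grad (dist K) y ((enorm (y - b))^-1 *: (y - b)).
Proof.
move=> K0 clK Kb Kc s0 srho cb.
have yc : y - c = - ((rho - enorm (y - b)) / enorm (y - b)) *: (y - b).
  have -> : y - c = (y - b) - (c - b) by rewrite opprB addrA subrK.
  rewrite cb -[X in X - _]scale1r -scalerBl; congr (_ *: _).
  by field; rewrite gt_eqF.
have ycn : enorm (y - c) = rho - enorm (y - b).
  by rewrite yc enormZ normrN gtr0_norm ?divr_gt0 ?subr_gt0// divfK ?gt_eqF.
have yb : y != b by apply: contraTneq s0 => ->; rewrite subrr enorm0 ltxx.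
have ync : y != c.
  apply: contraTneq srho => ync; move: ycn; rewrite ync subrr enorm0 => h.
  by rewrite -leNgt; lra.
have low z : rho + - enorm (z - c) <= dist K z.
  apply: dist_ge => // a /Kc; have := enormB_le c z a.
  by rewrite (enormC z c); lra.
have dE : dist K y = enorm (y - b).
  by apply/eqP; rewrite eq_le dist_le//=; have := low y; rewrite ycn; lra.
apply: has_grad_squeeze (has_grad_enorm yb) _ _ low _ => //.
- rewrite [X in has_grad _ _ X](_ : _ = - ((enorm (y - c))^-1 *: (y - c))).
    exact/has_gradDl/has_gradN/has_grad_enorm.
  rewrite ycn yc scalerA -scaleNr; congr (_ *: _).
  by field; rewrite !gt_eqF// subr_gt0.
- by rewrite ycn dE; lra.
- by move=> z; exact: dist_le.
Qed.

(** Every [y] near [b0] with [f y > 0] is regular: its nearest point [b] is seen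
    along the gradient of [f], that is, on the radius of the inner ball at [b]. *)
Lemma regular_point_near K Omega f g b0 r rho :
  K !=set0 -> closed K -> K `&` Omega = set0 -> K b0 -> 0 < r -> 0 < rho ->
  continuous_grad_on [set y | enorm (y - b0) < r] f g ->
  (forall y, enorm (y - b0) < r -> g y != 0) ->
  (forall y, enorm (y - b0) < r -> K y <-> f y = 0) ->
  (forall b, K b -> enorm (b - b0) < r ->
    ball_ (@enorm R n) (b + (rho / enorm (g b)) *: g b) rho `<=` Omega) ->
  (Omega `\` closure (singular_set K)) !=set0.
Proof.
move=> K0 clK KO Kb0 r0 rho0 fg g0 Kf balls.
have Kavoid c a : ball_ (@enorm R n) c rho `<=` Omega -> K a ->
    rho <= enorm (c - a).
  move=> cO Ka; rewrite leNgt; apply/negP => /cO Oa.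
  by have : (K `&` Omega) a by []; rewrite KO.
pose s := Num.min (r / 2) (rho / 2).
have s0 : 0 < s by rewrite lt_min !divr_gt0.
have sr : s <= r / 2 by rewrite ge_min lexx.
have srho : s <= rho / 2 by rewrite ge_min lexx orbT.
have b0b0 : enorm (b0 - b0) < r by rewrite subrr enorm0.
have fb0 : f b0 = 0 by apply/(Kf b0 b0b0).
have regular y : enorm (y - b0) < s -> 0 < f y ->
    Omega y /\ differentiable (dist K) y.
  move=> yb0 fy; have [b Kb dE] := dist_attained y K0 clK.
  have ybs : enorm (y - b) < s by rewrite -dE; apply: le_lt_trans (dist_le y Kb0) _.
  have br : enorm (b - b0) < r.
    by have := enormB_le b y b0; rewrite (enormC b y); lra.
  have fb : f b = 0 by apply/(Kf b br).
  have yb : y != b by apply: contraTneq fy => ->; rewrite fb ltxx.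
  have yb_gt0 : 0 < enorm (y - b) by rewrite enorm_gt0// subr_eq0.
  have gb0 : 0 < enorm (g b) by rewrite enorm_gt0// g0.
  have fpos z : enorm (z - y) < enorm (b - y) -> 0 < f z.
    have zr z' : enorm (z' - y) < enorm (b - y) -> enorm (z' - b0) < r.
      by rewrite (enormC b) => h; have := enormB_le z' y b0; lra.
    apply: (@convex_pos _ _ f [set z | enorm (z - y) < enorm (b - y)] y).
    - exact: segment_convex_eball.
    - by move=> z' /= /zr/fg[/has_grad_continuous].
    - move=> z' /= hz; apply/eqP => /(Kf z' (zr _ hz)).2 Kz.
      by move: hz; rewrite ltNge (enormC b) -dE (enormC z') dist_le.
    - by rewrite /= subrr enorm0 enormC.
    - exact: fy.
  have [|k k0 gk] := grad_on_sphere (fg b br).1 fb yb ltr01.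
    by move=> z zy _; exact: fpos.
  have gE : enorm (g b) = k * enorm (y - b) by rewrite gk enormZ ger0_norm.
  have kn0 : k != 0 by apply: contraTneq gb0; rewrite gE => ->; rewrite mul0r ltxx.
  set c := b + (rho / enorm (g b)) *: g b.
  have cb : c - b = (rho / enorm (y - b)) *: (y - b).
    rewrite /c addrC addKr gE gk scalerA; congr (_ *: _).
    by field; rewrite kn0 gt_eqF.
  have cO : ball_ (@enorm R n) c rho `<=` Omega by exact: balls.
  have ybrho : enorm (y - b) < rho by lra.
  split.
    apply: cO; rewrite /ball_/=.
    have -> : c - y = ((rho - enorm (y - b)) / enorm (y - b)) *: (y - b).
      have -> : c - y = (c - b) - (y - b) by rewrite opprB addrA subrK.
      rewrite cb -[X in _ - X]scale1r -scalerBl; congr (_ *: _).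
      by field; rewrite gt_eqF.
    by rewrite enormZ gtr0_norm ?divr_gt0 ?subr_gt0// divfK ?gt_eqF//; lra.
  apply: has_grad_differentiable.
  apply: (dist_differentiable_between K0 clK Kb _ yb_gt0 ybrho cb).
  by move=> a; exact: Kavoid.
have gg : 0 < dotp (g b0) (g b0) by rewrite -enorm_sqr exprn_gt0// enorm_gt0// g0.
have [q q0 fincr] := has_grad_incr (fg b0 b0b0).1 gg.
have gb0 : 0 < enorm (g b0) by rewrite enorm_gt0// g0.
have m0 : 0 < Num.min q (s / enorm (g b0)) by rewrite lt_min q0 divr_gt0.
have [t /andP[t0]] : exists t : R, 0 < t < Num.min q (s / enorm (g b0)).
  by exists (Num.min q (s / enorm (g b0)) / 2); apply/andP; split; lra.
rewrite lt_min ltr_pdivlMr// => /andP[tq ts].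
pose y := b0 + t *: g b0.
have yb0 : enorm (y - b0) < s by rewrite /y addrC addKr enormZ gtr0_norm.
have fy : 0 < f y by rewrite -fb0; exact: fincr.
exists y; split; first by have [] := regular y yb0 fy.
have yr : enorm (y - b0) < r by lra.
have /continuous_enormP/(_ _ fy)[q' q'0 fcont] := has_grad_continuous (fg y yr).1.
have : nbhs y [set z | enorm (z - b0) < s /\ 0 < f z].
  apply/nbhs_enormP; exists (Num.min q' (s - enorm (y - b0))).
    by rewrite lt_min q'0 subr_gt0.
  move=> z; rewrite lt_min => /andP[/fcont + zy]; rewrite ltr_norml => /andP[? ?].
  by split; [have := enormB_le z y b0|]; lra.
move=> W /(_ _ W)[z [[_ nd] [/regular zb /zb[]]]].
by move=> _ /nd.
Qed.

(** Balls of a fixed radius on the two sides of the hypersurface may both occur,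
    but having one on a given side is a closed condition, so that near some point
    only one side is needed. *)
Lemma inner_ball_regular_point K Omega S : closed K -> C1_hypersurface K ->
  K `&` Omega = set0 -> S !=set0 -> S `<=` K -> relatively_open K S ->
  inner_uniform_ball_condition Omega S ->
  (Omega `\` closure (singular_set K)) !=set0.
Proof.
move=> clK hK KO [b0 Sb0] SK [V oV SE] [rho rho0 balls].
have Kb0 := SK _ Sb0; have K0 : K !=set0 by exists b0.
have [f [g [r1 [r10 fg g0 Kf]]]] := hypersurface_equation hK Kb0.
have /nbhs_enormP[r2 r20 r2V] : nbhs b0 V.
  by move: Sb0; rewrite SE => -[_ Vb]; move: oV; rewrite openE => /(_ _ Vb).
pose side g' b := ball_ (@enorm R n) (b + (rho / enorm (g' b)) *: g' b) rho `<=` Omega.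
pose r := Num.min r1 r2.
have r0 : 0 < r by rewrite lt_min r10.
have rr1 z : enorm (z - b0) < r -> enorm (z - b0) < r1.
  by rewrite lt_min => /andP[].
have sides b : K b -> enorm (b - b0) < r ->
    side g b \/ side (fun z => - g z) b.
  move=> Kb; rewrite lt_min => /andP[br1 br2].
  have [|c [/(boundary_eballP c b rho0) cb cO]] := balls b.
    by rewrite SE; split=> //; exact: r2V.
  have cb_neq : c != b.
    by apply: contraTneq rho0 => cbE; rewrite -cb cbE subrr enorm0 ltxx.
  have [|h|h] := center_along_grad fg g0 Kf Kb br1 cb_neq.
  - move=> z Kz; rewrite (enormC b) cb leNgt; apply/negP => hz.
    have : (K `&` Omega) z by split=> //; apply: cO; rewrite /ball_/= enormC.
    by rewrite KO.
  - by left; rewrite /side -[X in X / _]cb -(enormC b) -h addrC subrK.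
  - right; rewrite /side enormN -[X in X / _]cb -(enormC b) scalerN -scaleNr -h.
    by rewrite addrC subrK.
(* Failure of the side g at some b1 persists near b1, which leaves the other
   side there. *)
have [[b1 [Kb1 b1r nside]]|allside] := pselect (exists b1, [/\ K b1,
    enorm (b1 - b0) < r & ~ side g b1]); last first.
  apply: (@regular_point_near K Omega f g b0 r rho) => //.
  - by move=> z /rr1; exact: fg.
  - by move=> z /rr1; exact: g0.
  - by move=> z /rr1; exact: Kf.
  - by move=> b Kb br; apply: contrapT => nb; apply: allside; exists b.
have [s s0 nsides] : exists2 s, 0 < s &
    forall b, K b -> enorm (b - b1) < s -> enorm (b - b0) < r -> ~ side g b.
  have [z [zb1 nOz]] : exists z,
      enorm (b1 + (rho / enorm (g b1)) *: g b1 - z) < rho /\ ~ Omega z.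
    apply: contrapT => hz; apply: nside => z zb; apply: contrapT => nOz.
    by apply: hz; exists z.
  have gb1 : 0 < enorm (g b1) by rewrite enorm_gt0// g0// rr1.
  set q := rho - enorm (b1 + (rho / enorm (g b1)) *: g b1 - z).
  have q0 : 0 < q by rewrite subr_gt0.
  (* This e makes the centre of the ball move by less than q / 2 through the
     rotation of the normal; another q / 2 is left for the motion of b. *)
  pose e := q * enorm (g b1) / (4 * rho).
  have e0 : 0 < e by rewrite divr_gt0 ?mulr_gt0.
  have [s s0 gs] := (fg b1 (rr1 _ b1r)).2 e e0.
  exists (Num.min s (q / 2)); first by rewrite lt_min s0 divr_gt0.
  move=> b Kb; rewrite lt_min => /andP[/gs gb bq] br hside; apply/nOz/hside.
  rewrite /ball_/=.
  have gb_gt0 : 0 < enorm (g b) by rewrite enorm_gt0// g0// rr1.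
  have -> : b + (rho / enorm (g b)) *: g b - z =
      (b1 + (rho / enorm (g b1)) *: g b1 - z) + (b - b1) +
      rho *: ((enorm (g b))^-1 *: g b - (enorm (g b1))^-1 *: g b1).
    by apply/rowP => i; rewrite !mxE; ring.
  apply: le_lt_trans (enormD _ _) _.
  have := enormD (b1 + (rho / enorm (g b1)) *: g b1 - z) (b - b1).
  have : enorm (rho *: ((enorm (g b))^-1 *: g b - (enorm (g b1))^-1 *: g b1)) <
      q / 2.
    rewrite enormZ gtr0_norm//.
    apply: (@le_lt_trans _ _ (rho * (2 * enorm (g b - g b1) / enorm (g b1)))).
      by rewrite ler_pM2l// normalized_dist// g0// rr1.
    rewrite mulrA ltr_pdivrMr// mulrCA -ltr_pdivlMl// -ltr_pdivlMl//.
    rewrite (_ : _^-1 * _ = e)//.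
    by rewrite /e; field; rewrite gt_eqF.
  rewrite /q; move: bq; rewrite /q; lra.
pose r' := Num.min s (r - enorm (b1 - b0)).
have r'0 : 0 < r' by rewrite lt_min s0 subr_gt0.
have r'r z : enorm (z - b1) < r' -> enorm (z - b0) < r.
  rewrite lt_min => /andP[_]; have := enormB_le z b1 b0; lra.
apply: (@regular_point_near K Omega (fun z => - f z) (fun z => - g z) b1 r' rho) => //.
- move=> z /r'r/rr1/fg[gz gcont]; split; first exact: has_gradN.
  move=> e /gcont[t t0 h]; exists t => // y /h.
  by rewrite -opprD enormN.
- by move=> z /r'r/rr1/g0; rewrite oppr_eq0.
- move=> z /r'r/rr1/Kf ->; split=> [->|/eqP]; first by rewrite oppr0.
  by rewrite oppr_eq0 => /eqP.
- move=> b Kb br'; have br := r'r _ br'.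
  have [/nsides|//] := sides b Kb br.
  by move: br'; rewrite lt_min => /andP[bs _] /(_ Kb bs br).
Qed.

End BallToRegular.

(** * From regular points to inner balls *)

Section RegularToBall.
Context {R : realType} {n : nat}.
Implicit Types (y a b e : 'rV[R]_n) (K Omega : set 'rV[R]_n).
Implicit Types (f : 'rV[R]_n -> R) (g : 'rV[R]_n -> 'rV[R]_n).

(** The ball is connected, meets [Omega] and avoids its boundary. *)
Lemma ball_below_dist K Omega y : K !=set0 -> closed K -> boundary Omega = K ->
  Omega y -> ball_ (@enorm R n) y (dist K y) `<=` Omega.
Proof.
move=> K0 clK bO Oy z; rewrite /ball_/= enormC => zy.
apply: (@convex_subset_of_boundary_free _ _
  [set w | enorm (w - y) < dist K y] Omega y _ _ _ Oy z zy).
- exact: segment_convex_eball.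
- by move=> w /= wy; rewrite bO => /(dist_le y); rewrite enormC leNgt wy.
- by rewrite /= subrr enorm0; apply: le_lt_trans (enorm_ge0 _) zy.
Qed.

(** Lagrange multipliers for the problem of approaching [b] inside the superlevel
    set [d <= dist K _].  The directions in which the distance increases cannot
    approach [b], so [y - b] is a positive multiple of the gradient [e]; if the
    constraint were slack, moving along [- e] would approach [b]. *)
Lemma superlevel_minimizer K b b' y d r : K !=set0 -> closed K ->
  K b -> K b' -> dist K y = enorm (y - b') -> 0 < d -> d <= dist K y -> 0 < r ->
  differentiable (dist K) y ->
  (forall z, enorm (z - y) < r -> d <= dist K z ->
    enorm (y - b) <= enorm (z - b)) ->
  dist K y = d /\
  exists2 e, enorm e = 1 & y - b' = d *: e /\ y - b = enorm (y - b) *: e.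
Proof.
move=> K0 clK Kb Kb' dE d0 dy r0 /differentiable_has_grad.
set e := \row_i _ => dgrad ymin.
have yb'0 : 0 < enorm (y - b') by rewrite -dE; apply: lt_le_trans dy.
have yb0 : 0 < enorm (y - b).
  by apply: lt_le_trans d0 _; apply: le_trans dy _; exact: dist_le.
have neq_of_gt0 c : 0 < enorm (y - c) -> y != c.
  by apply: contraTneq => ->; rewrite subrr enorm0 ltxx.
have eE := grad_dist Kb' dE (neq_of_gt0 _ yb'0) dgrad.
have e1 : enorm e = 1.
  by rewrite eE enormZ gtr0_norm ?invr_gt0// mulVf// gt_eqF.
have [||k k0 kE] := @halfspace_dual R n e ((enorm (y - b))^-1 *: (y - b)).
- by apply: contra_eq_neq e1 => ->; rewrite enorm0 eq_sym oner_neq0.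
- move=> v ev; have [q q0 dincr] := has_grad_incr dgrad ev.
  apply: (has_grad_ge0 (has_grad_enorm (neq_of_gt0 _ yb0))) => t t0.
  have v1 : 0 < enorm v + 1 by rewrite ltr_wpDl ?enorm_ge0.
  pose m := Num.min t (Num.min q (r / (enorm v + 1))).
  have m0 : 0 < m by rewrite !lt_min t0 q0 divr_gt0.
  have : m / 2 < m by lra.
  rewrite {2}/m !lt_min ltr_pdivlMr// => /and3P[mt mq mr].
  have m20 : 0 < m / 2 by lra.
  exists (m / 2); split=> //; apply: ymin.
    rewrite addrC addKr enormZ gtr0_norm//; apply: le_lt_trans mr.
    by rewrite ler_pM2l// lerDl.
  by apply: le_trans dy _; apply/ltW/dincr.
have k1 : k = 1.
  have := congr1 (@enorm R n) kE.
  by rewrite !enormZ e1 mulr1 (ger0_norm k0) gtr0_norm ?invr_gt0// mulVf ?gt_eqF.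
have ybE : y - b = enorm (y - b) *: e.
  by move: kE; rewrite k1 scale1r => <-; rewrite scalerA divff ?scale1r ?gt_eqF.
have yb'E : y - b' = dist K y *: e.
  by rewrite eE dE scalerA divff ?scale1r ?gt_eqF.
have dyE : dist K y = d.
  apply/eqP; rewrite eq_le dy andbT leNgt; apply/negP => dlt.
  pose m := Num.min (dist K y - d) (Num.min r (enorm (y - b))).
  have m0 : 0 < m by rewrite !lt_min subr_gt0 dlt r0.
  have : m / 2 < m by lra.
  rewrite {2}/m !lt_min => /and3P[md mr mb].
  have m20 : 0 < m / 2 by lra.
  have := ymin (y - (m / 2) *: e).
  have -> : y - (m / 2) *: e - b = (enorm (y - b) - m / 2) *: e.
    by rewrite addrAC [y - b]ybE -scalerBl -ybE.
  have -> : y - (m / 2) *: e - y = - ((m / 2) *: e) by rewrite addrAC subrr add0r.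
  have := dist_lipschitz (y - (m / 2) *: e) y K0 clK.
  rewrite opprB addrCA subrr addr0 enormN !enormZ e1 !mulr1.
  have l0 : 0 < enorm (y - b) - m / 2 by rewrite subr_gt0.
  rewrite (gtr0_norm m20) (gtr0_norm l0) => hlip /(_ mr).
  by move=> h; have := h _; lra.
by split=> //; exists e => //; rewrite -{1}dyE.
Qed.

(** By Rolle's theorem two distinct zeros of [f] on a line of direction [e] would
    give a zero of [dotp (g _) e] between them. *)
Lemma transversal_eq f g a b b' e s :
  continuous_grad_on [set y | enorm (y - a) < s] f g ->
  (forall z, enorm (z - a) < s -> dotp (g z) e != 0) ->
  enorm (b - a) < s -> enorm (b' - a) < s -> f b = f b' ->
  (exists k : R, b - b' = k *: e) -> b = b'.
Proof.
move=> fg transv bs b's fbb' [k bb'].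
have seg (t : R) : 0 <= t <= 1 -> enorm (b' + t *: (b - b') - a) < s.
  by move=> /andP[t0 t1]; exact: (@segment_convex_eball R n a s b' b t).
have [||t t01] := @rolle_segment R n f g b' (b - b').
- by move=> t /seg/fg[].
- by rewrite addrC subrK.
rewrite {2}bb' dotpZr => /eqP; rewrite mulf_eq0 (negPf (transv _ (seg t t01))).
by rewrite orbF => /eqP k0; apply/subr0_eq; rewrite bb' k0 scale0r.
Qed.

(** The set [S] consists of the points of [K] close to the point [a] nearest to a
    regular point [x], and all balls have the radius [dist K x]. *)
Lemma regular_point_inner_ball K Omega : K !=set0 -> closed K ->
  C1_hypersurface K -> open Omega -> boundary Omega = K ->
  (Omega `\` closure (singular_set K)) !=set0 ->
  exists S : set 'rV[R]_n,
    [/\ S !=set0, S `<=` K, relatively_open K S &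
        inner_uniform_ball_condition Omega S].
Proof.
move=> K0 clK hK oO bO [x [Ox nSx]].
have OK z : Omega z -> ~ K z by rewrite -bO boundary_open// => ? [].
have [r r0 xr] : exists2 r, 0 < r & forall y, enorm (y - x) < r ->
    Omega y /\ differentiable (dist K) y.
  have /nbhs_enormP[r1 r10 r1O] : nbhs x Omega.
    by move: oO; rewrite openE => /(_ _ Ox).
  have [r2 r20 r2S] : exists2 r, 0 < r & forall y, enorm (y - x) < r ->
      ~ singular_set K y.
    apply: contrapT => h; apply: nSx => A /nbhs_enormP[r r0 rA].
    apply: contrapT => hA; apply: h; exists r => // y /rA Ay Sy.
    by apply: hA; exists y.
  exists (Num.min r1 r2); first by rewrite lt_min r10.
  move=> y; rewrite lt_min => /andP[/r1O Oy /r2S nS]; split=> //.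
  by apply: contrapT => nd; apply: nS; split=> //; exact: OK.
set d := dist K x; have d0 : 0 < d by apply: dist_gt0 => //; exact: OK.
have [a Ka dxa] := dist_attained x K0 clK; rewrite -/d in dxa.
have [f [g [r1 [r10 fg g0 Kf]]]] := hypersurface_equation hK Ka.
have aa : enorm (a - a) < r1 by rewrite subrr enorm0.
have ga0 : 0 < enorm (g a) by rewrite enorm_gt0// g0.
have normal_line y : enorm (y - a) = d -> d <= dist K y ->
    y - a = (d / enorm (g a)) *: g a \/ y - a = - (d / enorm (g a)) *: g a.
  move=> yad dy; have ya : y != a.
    by apply: contraTneq d0 => yaE; rewrite -yad yaE subrr enorm0 ltxx.
  have [z Kz||] := center_along_grad fg g0 Kf Ka aa ya.
  - rewrite (enormC a) yad enormC; apply: le_trans dy _; exact: dist_le.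
  - by rewrite (enormC a) yad; left.
  - by rewrite (enormC a) yad; right.
have xline := normal_line x (esym dxa) (lexx _).
(* The bound r' <= d excludes the reflection of x in a, which is at distance 2 d
   from x and may also have a as a nearest point. *)
pose r' := Num.min (r / 2) d.
have r'0 : 0 < r' by rewrite lt_min d0 divr_gt0.
have r'r : r' <= r / 2 by rewrite ge_min lexx.
have r'd : r' <= d by rewrite ge_min lexx orbT.
pose C := [set y | enorm (y - x) <= r'] `&` [set y | d <= dist K y].
have Cx : C x by split; [rewrite /= subrr enorm0 ltW|exact: lexx].
have clC : closed C.
  apply: closedI.
    apply: (closed_comp _ (@closed_le _ r')) => y _; exact: continuous_enormB.
  apply: (closed_comp _ (@closed_ge _ d)) => y _; exact: continuous_dist.
have Cuniq y : C y -> enorm (a - y) <= d -> y = x.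
  move=> [/= yx dy]; rewrite enormC => yad.
  have yadE : enorm (y - a) = d.
    by apply/eqP; rewrite eq_le yad/=; apply: le_trans dy _; exact: dist_le.
  have far (k : R) : `|k| = 2 -> y - x = k *: ((d / enorm (g a)) *: g a) -> y = x.
    move=> k2 yxE; move: yx; rewrite yxE !enormZ k2.
    rewrite (gtr0_norm (divr_gt0 d0 ga0)) divfK ?gt_eqF// => h.
    by have := le_trans h r'd; rewrite ger_pMl// lern1.
  have yxE : y - x = (y - a) - (x - a) by rewrite opprB addrA subrK.
  have [yE|yE] := normal_line y yadE dy; have [xE|xE] := xline.
  - by apply/subr0_eq; rewrite yxE yE xE subrr.
  - apply: (far 2); first by rewrite ger0_norm.
    by rewrite yxE yE xE scaleNr opprK [RHS]scaler_nat mulr2n.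
  - apply: (far (- 2)); first by rewrite normrN ger0_norm.
    by rewrite yxE yE xE !scaleNr scaler_nat mulr2n opprD.
  - by apply/subr0_eq; rewrite yxE yE xE subrr.
(* By compactness, points of C almost as close to a as x are close to x. *)
pose eps := Num.min r' (d / 4).
have eps0 : 0 < eps by rewrite lt_min r'0 divr_gt0.
have [m dm Cm] : exists2 m, d < m &
    forall y, C y -> enorm (a - y) < m -> enorm (y - x) < eps.
  pose F := C `&` [set y | eps <= enorm (y - x)].
  have clF : closed F.
    apply: closedI => //.
    apply: (closed_comp _ (@closed_ge _ eps)) => y _; exact: continuous_enormB.
  have [F0|/set0P/negP/negPn/eqP F0] := pselect (F !=set0); last first.
    exists (d + 1); first by rewrite ltrDl.
    move=> y Cy _; rewrite ltNge; apply/negP => hy.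
    by have : F y by []; rewrite F0.
  have [y0 [Cy0 /= y0x] y0min] := closed_nearest a F0 clF.
  exists (enorm (a - y0)).
    rewrite ltNge; apply/negP => /(Cuniq y0 Cy0) y0E.
    by move: y0x; rewrite y0E subrr enorm0 leNgt eps0.
  move=> y Cy ay; rewrite ltNge; apply/negP => hy.
  by have := y0min y (conj Cy hy); rewrite leNgt ay.
have [s0 s00 gs0] := (fg a aa).2 _ (divr_gt0 ga0 (ltr0Sn R 1)).
pose s := Num.min s0 r1.
have s_gt0 : 0 < s by rewrite lt_min s00.
have sr1 z : enorm (z - a) < s -> enorm (z - a) < r1.
  by rewrite lt_min => /andP[].
pose eta := Num.min ((m - d) / 2) (Num.min (d / 8) (s / 2)).
have eta0 : 0 < eta by rewrite !lt_min !divr_gt0// subr_gt0.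
exists (K `&` [set b | enorm (b - a) < eta]); split.
- by exists a; split; rewrite /= ?subrr ?enorm0.
- by move=> b [].
- by exists [set b | enorm (b - a) < eta] => //; exact: open_eball.
exists d => // b [Kb /=]; rewrite !lt_min => /and3P[bm bd bs].
have C0 : C !=set0 by exists x.
have [y Cy ymin] := closed_nearest b C0 clC.
have ybx : enorm (y - b) <= d + enorm (b - a).
  rewrite (enormC y); apply: le_trans (ymin x Cx) _; rewrite enormC.
  by have := enormB_le x a b; rewrite (enormC a b); lra.
have : enorm (y - x) < eps.
  apply: Cm => //; have := enormB_le y b a; rewrite (enormC a); lra.
rewrite lt_min => /andP[yxr' yxd].
have [Oy dydiff] : Omega y /\ differentiable (dist K) y by apply: xr; lra.
have [b' Kb' dyE] := dist_attained y K0 clK.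
have r'' : 0 < r' - enorm (y - x) by rewrite subr_gt0.
have [|dist_y [e e1 [yb' yb]]] :=
    superlevel_minimizer K0 clK Kb Kb' dyE d0 Cy.2 r'' dydiff.
  move=> z zy dz; rewrite !(enormC _ b); apply: ymin; split=> //=.
  have := enormB_le z y x; lra.
have lamd : d <= enorm (y - b) by rewrite -dist_y; exact: dist_le.
have bb' : b - b' = (d - enorm (y - b)) *: e.
  have -> : b - b' = (y - b') - (y - b).
    by apply/rowP => i; rewrite !mxE; ring.
  by rewrite yb' {1}yb -scalerBl.
have b'a : enorm (b' - a) <= 2 * enorm (b - a).
  have -> : b' - a = (b - a) - (b - b').
    by apply/rowP => i; rewrite !mxE; ring.
  apply: le_trans (enormD _ _) _; rewrite enormN bb' enormZ e1 mulr1.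
  by rewrite ler0_norm ?subr_le0//; lra.
(* The vectors x - a and d e = y - b' are within d / 2 of each other, and g z is
   within |g a| / 2 of g a; since |(g a).(x - a)| = |g a| d, the product
   (g z).e cannot vanish. *)
have transv z : enorm (z - a) < s -> dotp (g z) e != 0.
  rewrite lt_min => /andP[/gs0 gz _]; apply/negP => /eqP gze.
  have gze0 : dotp (g z) (y - b') = 0 by rewrite yb' dotpZr gze mulr0.
  pose D := (y - x) - (b' - a).
  have Dd : enorm D < d / 2.
    by have := enormD (y - x) (- (b' - a)); rewrite enormN -/D; lra.
  have xaE : x - a = (y - b') - D by apply/rowP => i; rewrite !mxE; ring.
  have E : dotp (g a) (x - a) = - dotp (g a) D - dotp (g z - g a) (y - b').
    by rewrite xaE dotpBr dotpBl gze0; ring.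
  have lt1 : `|dotp (g a) (x - a)| < enorm (g a) * d.
    rewrite E; apply: le_lt_trans (ler_normB _ _) _; rewrite normrN.
    have := norm_dotp_le (g a) D; have := norm_dotp_le (g z - g a) (y - b').
    rewrite yb' enormZ e1 mulr1 (gtr0_norm d0).
    have : enorm (g z - g a) * d < enorm (g a) / 2 * d by rewrite ltr_pM2r.
    have : enorm (g a) * enorm D < enorm (g a) * (d / 2) by rewrite ltr_pM2l.
    lra.
  have : `|dotp (g a) (x - a)| = enorm (g a) * d.
    have dag : dotp (g a) ((d / enorm (g a)) *: g a) = enorm (g a) * d.
      by rewrite dotpZr -enorm_sqr; field; rewrite gt_eqF.
    have pos : 0 < enorm (g a) * d by rewrite mulr_gt0.
    have [->|->] := xline; first by rewrite dag gtr0_norm.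
    by rewrite scaleNr dotpNr normrN dag gtr0_norm.
  by move=> h; move: lt1; rewrite h ltxx.
have bs' : enorm (b - a) < s by have := enorm_ge0 (b - a); lra.
have b's' : enorm (b' - a) < s by lra.
have bE : b = b'.
  apply: (@transversal_eq f g a b b' e s) => //.
  - by move=> z /sr1; exact: fg.
  - by rewrite ((Kf b (sr1 _ bs')).1 Kb) ((Kf b' (sr1 _ b's')).1 Kb').
  - by exists (d - enorm (y - b)).
exists y; split.
  by apply/(boundary_eballP y b d0); rewrite bE -dyE.
by rewrite -{1}dist_y; exact: ball_below_dist.
Qed.

End RegularToBall.

Theorem theorem2p8 (R : realType) (n : nat) (K Omega : set 'rV[R]_n)
    (K_nonempty : K !=set0) (K_closed : closed K)
    (K_hypersurface : C1_hypersurface K)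
    (Omega_open : open Omega) (Omega_boundary : boundary Omega = K) :
  (Omega `\` closure (singular_set K)) !=set0 <->
  exists S : set 'rV[R]_n,
    [/\ S !=set0, S `<=` K, relatively_open K S &
        inner_uniform_ball_condition Omega S].
Proof.
split; first exact: regular_point_inner_ball.
move=> [S [S0 SK openS ballS]].
apply: (inner_ball_regular_point (S := S)) => //.
by rewrite -Omega_boundary boundary_open// setDKI.
Qed.
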